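(* Let $n\ge 1$ and let $\theta,\zeta$ be arbitrary positive real numbers. For a permutation $\pi_n\in\mathfrak S_n$ let $\ell=\ell(\pi_n)$ and $u=u(\pi_n)$ be the numbers of its proper lower records and proper upper records. Then the formula $$P_n^{(\theta,\zeta)}(\pi_n)=\frac{\theta^{\ell}\zeta^{u}}{(\theta+\zeta)_{n-1}},\qquad \pi_n\in\mathfrak S_n,$$ defines a probability distribution on $\mathfrak S_n$, which assigns the same probability to every permutation with $\ell+1$ lower and $u+1$ upper records.
   Context: $\mathfrak S_n$ is the set of permutations of $[n]=\{1,\dots,n\}$, written $\pi_n=(\pi_{n1},\dots,\pi_{nn})$. The entry $\pi_{nj}$ is a lower record if $\pi_{nj}=\min(\pi_{n1},\dots,\pi_{nj})$ and an upper record if $\pi_{nj}=\max(\pi_{n1},\dots,\pi_{nj})$. The first entry $\pi_{n1}$ is an improper lower and upper record; all records $\pi_{nj}$ with $j\ge2$ are called proper. Thus $\pi_n$ has $\ell+1$ lower and $u+1$ upper records in total. $(x)_m=x(x+1)\cdots(x+m-1)$ is the rising factorial, $(x)_0=1$. *)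

(* Defs.v *)
From HB Require Import structures.
From mathcomp Require Import all_boot all_order all_algebra all_fingroup.
From mathcomp Require Import reals.

Set Implicit Arguments.
Unset Strict Implicit.
Unset Printing Implicit Defensive.

Import Order.TTheory GRing.Theory Num.Theory.

Local Open Scope ring_scope.

(* Positions and values of 'S_n are numbered from 0: [entry s j] is the
   1-based value, in {1, ..., n}, at the 1-based position j + 1. *)
Definition entry (n : nat) (s : 'S_n) (j : 'I_n) : nat := (s j).+1.

(* The range of the minimum contains j, and n, being the largest possible
   entry, is neutral on it. *)
Definition lower_record (n : nat) (s : 'S_n) (j : 'I_n) : bool :=
  entry s j == \big[minn/n]_(i < n | (i <= j)%N) entry s i.

Definition upper_record (n : nat) (s : 'S_n) (j : 'I_n) : bool :=
  entry s j == (\max_(i < n | (i <= j)%N) entry s i)%N.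

Definition num_lower (n : nat) (s : 'S_n) : nat :=
  #|[set j : 'I_n | lower_record s j]|.

Definition num_upper (n : nat) (s : 'S_n) : nat :=
  #|[set j : 'I_n | upper_record s j]|.

(* A record is proper when it is not at the first position, which is 0 here. *)
Definition num_proper_lower (n : nat) (s : 'S_n) : nat :=
  #|[set j : 'I_n | (0 < j)%N && lower_record s j]|.

Definition num_proper_upper (n : nat) (s : 'S_n) : nat :=
  #|[set j : 'I_n | (0 < j)%N && upper_record s j]|.

Definition rising_factorial (R : realType) (x : R) (m : nat) : R :=
  \prod_(i < m) (x + i%:R).

Definition record_prob (R : realType) (n : nat) (theta zeta : R) (s : 'S_n) : R :=
  theta ^+ num_proper_lower s * zeta ^+ num_proper_upper s
    / rising_factorial (theta + zeta) n.-1.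

Definition is_prob_distribution (R : realType) (T : finType) (p : T -> R) : Prop :=
  (forall x, 0 <= p x) /\ \sum_(x : T) p x = 1.

(* Main.v *)
Require Import Defs.
From mathcomp Require Import all_boot all_order all_algebra all_fingroup.
From mathcomp Require Import reals.

Import Order.TTheory GRing.Theory Num.Theory.

Local Open Scope ring_scope.

(** Build a permutation of [n + 1] from one of [n] by choosing the relative rank
    of a new last entry. The earlier entries keep their relative order, hence
    their record status, and the new entry is a proper lower (upper) record iff
    its rank is the smallest (largest). Summing over the n + 1 ranks multiplies
    the total weight by theta + zeta + (n - 1). *)

Lemma leq_bigmin (I : finType) (P : pred I) (F : I -> nat) (m n : nat) :
  (m <= \big[minn/n]_(i | P i) F i)%N =
  (m <= n)%N && [forall (i | P i), (m <= F i)%N].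
Proof.
rewrite -big_andE; elim/big_rec2: _ => [|i b k _ IH]; first by rewrite andbT.
by rewrite leq_min IH andbCA.
Qed.

(* The lower records are the case [r := leq], the upper ones [r := geq]. *)
Definition record (r : rel nat) (n : nat) (s : 'S_n) (j : 'I_n) : bool :=
  [forall (i : 'I_n | (i <= j)%N), r (s j) (s i)].

Definition num_proper (r : rel nat) (n : nat) (s : 'S_n) : nat :=
  #|[set j : 'I_n | (0 < j)%N && record r n s j]|.

Lemma lower_recordE (n : nat) (s : 'S_n) (j : 'I_n) :
  lower_record s j = record leq n s j.
Proof.
have bigmin_le : (\big[minn/n]_(i < n | (i <= j)%N) entry s i <= entry s j)%N.
  set m := (X in (X <= _)%N); have := leqnn m.
  by rewrite {2}/m leq_bigmin => /andP[_ /forall_inP]; apply.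
(* The default [n] of the minimum adds the condition [entry s j <= n], which is [ltn_ord]. *)
by rewrite /lower_record eqn_leq bigmin_le andbT leq_bigmin ltn_ord.
Qed.

Lemma upper_recordE (n : nat) (s : 'S_n) (j : 'I_n) :
  upper_record s j = record geq n s j.
Proof.
rewrite /upper_record eqn_leq leq_bigmax_cond //=.
by apply/bigop.bigmax_leqP/forall_inP.
Qed.

Lemma num_proper_lowerE (n : nat) (s : 'S_n) :
  num_proper_lower s = num_proper leq n s.
Proof. by apply: eq_card => j; rewrite !inE lower_recordE. Qed.

Lemma num_proper_upperE (n : nat) (s : 'S_n) :
  num_proper_upper s = num_proper geq n s.
Proof. by apply: eq_card => j; rewrite !inE upper_recordE. Qed.

(** The first position is compared only with itself, so by reflexivity it is always a record: the
    improper one. *)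
Lemma card_record (r : rel nat) (n : nat) (s : 'S_n.+1) :
  reflexive r -> #|[set j | record r n.+1 s j]| = (num_proper r n.+1 s).+1.
Proof.
move=> rxx; rewrite (cardsD1 ord0) inE.
have -> : record r n.+1 s ord0.
  by apply/forall_inP => i; rewrite leqn0 => /eqP/(@ord_inj _ i ord0) ->.
by congr _.+1; apply: eq_card => j; rewrite !inE lt0n.
Qed.

(** Appending the value [v] renumbers the old values by [bump v], which [r] does not notice. The new
    entry comes after every other, hence is compared with all values; its position is never the
    first, so a record there is proper. *)
Lemma num_proper_lift_perm (r : rel nat) (n : nat) (v : 'I_n.+2) (s : 'S_n.+1) :
    (forall h, {mono bump h : a b / r a b}) ->
  num_proper r n.+2 (lift_perm ord_max v s) =
  (num_proper r n.+1 s + [forall w : 'I_n.+2, r v w])%N.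
Proof.
move=> r_bump; rewrite /num_proper -!sum1dep_card big_mkcond big_ord_recr /=.
congr addn.
  rewrite [RHS]big_mkcond; apply: eq_bigr => j _.
  have -> : widen_ord (leqnSn n.+1) j = lift ord_max j.
    by apply: ord_inj; rewrite lift_max.
  congr (if _ && _ then _ else _).
  apply/forall_inP/forall_inP => rec_j i le_ij.
    have := rec_j (lift ord_max i); rewrite !lift_max => /(_ le_ij).
    by rewrite !lift_perm_lift r_bump.
  (* A position up to [j] is an old one: the appended position exceeds every lifted one. *)
  case: (unliftP ord_max i) le_ij => [k|] ->; rewrite !lift_max.
    by move=> /rec_j; rewrite !lift_perm_lift r_bump.
  by rewrite leqNgt ltn_ord.
have -> : record r n.+2 (lift_perm ord_max v s) ord_max =
          [forall w : 'I_n.+2, r v w].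
  apply/forall_inP/forallP => rec_v i; last by rewrite lift_perm_id.
  (* Surjectivity: the value [i] is attained at its preimage. *)
  have := rec_v ((lift_perm ord_max v s)^-1%g i) (leq_ord _).
  by rewrite lift_perm_id permKV.
by case: [forall _, _].
Qed.

Lemma forall_leq_ord (n : nat) (v : 'I_n.+1) :
  [forall w : 'I_n.+1, (v <= w)%N] = (v == ord0).
Proof.
apply/forallP/eqP => [/(_ ord0)|-> //].
by rewrite leqn0 => /eqP v0; apply: val_inj.
Qed.

Lemma forall_geq_ord (n : nat) (v : 'I_n.+1) :
  [forall w : 'I_n.+1, geq v w] = (v == ord_max).
Proof.
apply/forallP/eqP => [/(_ ord_max) /= le_nv|-> w]; last exact: leq_ord.
by apply: val_inj; apply/eqP; rewrite eqn_leq leq_ord.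
Qed.

(** The value at [i] gives back [v] and the other values give back [s]; injectivity suffices because
    (n + 1) n! = (n + 1)!. *)
Lemma lift_perm_bij (n : nat) (i : 'I_n.+1) :
  bijective (fun p : 'I_n.+1 * 'S_n => lift_perm i p.1 p.2).
Proof.
apply: inj_card_bij => [[v s] [w t] /= eq_vw|]; last first.
  by rewrite card_prod card_ord !card_Sn factS.
have {}eq_vs k : lift_perm i v s k = lift_perm i w t k by rewrite eq_vw.
have eq_v : v = w by have := eq_vs i; rewrite !lift_perm_id.
congr (_, _) => //; apply/permP => k.
by have := eq_vs (lift i k); rewrite !lift_perm_lift eq_v => /lift_inj.
Qed.

Lemma sum_weights (R : realType) (theta zeta : R) (n : nat) :
  \sum_(s : 'S_n.+1) theta ^+ num_proper_lower s * zeta ^+ num_proper_upper s =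
  rising_factorial (theta + zeta) n.
Proof.
elim: n => [|n IH].
  have no_proper r (s : 'S_1) : num_proper r 1 s = 0%N.
    by apply: eq_card0 => j; rewrite !inE ord1.
  rewrite /rising_factorial big_ord0 (eq_bigr (fun=> 1)) => [|s _].
    by rewrite sumr_const card_Sn.
  by rewrite num_proper_lowerE num_proper_upperE !no_proper mulr1.
rewrite /rising_factorial big_ord_recr /= -[X in X * _]IH.
rewrite (reindex _ (onW_bij _ (lift_perm_bij n.+1 ord_max))) /=.
have bump_leq h : {mono bump h : a b / (a <= b)%N} by apply: leq_bump2.
have bump_geq h : {mono bump h : a b / geq a b} by move=> a b; apply: leq_bump2.
rewrite -(pair_bigA _ (fun v s =>
  theta ^+ num_proper_lower (lift_perm ord_max v s) *
  zeta ^+ num_proper_upper (lift_perm ord_max v s))) /=.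
(* Each weight splits into the weight of [s] and a factor depending on [v] alone, so the double sum
   becomes a product. *)
under eq_bigr => v _ do under eq_bigr => s _ do
  rewrite num_proper_lowerE num_proper_upperE !num_proper_lift_perm //
    forall_leq_ord forall_geq_ord -num_proper_lowerE -num_proper_upperE
    !exprD mulrACA.
under eq_bigr => v _ do rewrite -mulr_suml.
rewrite -mulr_sumr; congr (_ * _).
(* The lowest rank contributes [theta], the highest [zeta], and each of the [n] ranks between them
   1. *)
rewrite big_ord_recl big_ord_recr /= mulr1 mul1r.
rewrite (eq_bigr (fun=> 1)) => [|i _]; last first.
  rewrite (_ : (_ == ord_max) = false) ?mulr1 //.
  by apply/negbTE; rewrite -val_eqE /= /bump /= add1n eqSS ltn_eqF.
rewrite (_ : lift ord0 ord_max == ord_max) ?sumr_const ?card_ord.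
  by rewrite !expr1 addrA addrAC.
by rewrite -val_eqE.
Qed.

Theorem proposition2 (R : realType) (n : nat) (theta zeta : R)
    (hn : (1 <= n)%N) (htheta : 0 < theta) (hzeta : 0 < zeta) :
  is_prob_distribution (fun s : 'S_n => record_prob theta zeta s) /\
  (forall (l u : nat) (s t : 'S_n),
     num_lower s = l.+1 -> num_upper s = u.+1 ->
     num_lower t = l.+1 -> num_upper t = u.+1 ->
     record_prob theta zeta s = record_prob theta zeta t).
Proof.
case: n hn => // n _.
(* Positivity of the denominator gives both nonnegative quotients and a legitimate normalization. *)
have rising_gt0 : 0 < rising_factorial (theta + zeta) n.
  by apply: prodr_gt0 => i _; rewrite ltr_wpDr ?addr_gt0.
split; first split.
- by move=> s; rewrite divr_ge0 ?mulr_ge0 ?exprn_ge0 ?ltW.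
- by rewrite -mulr_suml sum_weights divff ?gt_eqF.
(* The total counts determine the proper ones, which are all that the formula sees of a
   permutation. *)
have num_lowerS (s : 'S_n.+1) : num_lower s = (num_proper_lower s).+1.
  rewrite num_proper_lowerE -card_record //.
  by apply: eq_card => j; rewrite !inE lower_recordE.
have num_upperS (s : 'S_n.+1) : num_upper s = (num_proper_upper s).+1.
  rewrite num_proper_upperE -card_record => [|x]; last exact: leqnn.
  by apply: eq_card => j; rewrite !inE upper_recordE.
move=> l u s t; rewrite !num_lowerS !num_upperS /record_prob.
by move=> [->] [->] [->] [->].
Qed.
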